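(* Let $(\Omega,\mathcal{F})$ and $(\Omega',\mathcal{F}')$ be measurable spaces, let $K$ be a Markov kernel from $(\Omega,\mathcal{F})$ to $(\Omega',\mathcal{F}')$, and let $Q_0,\dots,Q_M$ ($M\ge1$) be probability measures on $(\Omega,\mathcal{F})$ such that $Q_1,\dots,Q_M\ll Q_0$. Then $$\chi^2(KQ_0|KQ_1,\dots,KQ_M)\preceq\chi^2(Q_0|Q_1,\dots,Q_M),$$ where $\preceq$ denotes the Loewner order on symmetric matrices (i.e. the difference of the right and left sides is positive semi-definite).
   Context: A Markov kernel $K$ from $(\Omega,\mathcal{F})$ to $(\Omega',\mathcal{F}')$ is a map $K:\mathcal{F}'\times\Omega\to[0,1]$ such that $A\mapsto K(A,x)$ is a probability measure for each $x$ and $x\mapsto K(A,x)$ is measurable for each $A$. For a finite signed measure $\mu$ on $(\Omega,\mathcal{F})$, $K\mu$ is the signed measure $K\mu(A):=\int K(A,x)\,d\mu(x)$. For probability measures $P_0,P_1,\dots,P_M$ with $P_1,\dots,P_M\ll P_0$, the $\chi^2$-divergence matrix $\chi^2(P_0|P_1,\dots,P_M)$ is the $M\times M$ matrix with $(j,k)$ entry $\int\frac{dP_j}{dP_0}\,dP_k-1$.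
   Formalization: The diagonal entries of χ²(Q_0|Q_1,…,Q_M) are assumed finite, since otherwise the matrices may have infinite entries and the Loewner order is undefined; finiteness of all entries of χ²(KQ_0|KQ_1,…,KQ_M) is then proved. *)

(* Defs.v *)
From HB Require Import structures.
From mathcomp Require Import all_boot all_order all_algebra.
From mathcomp Require Import all_classical all_reals all_analysis.
Import Order.TTheory GRing.Theory Num.Theory numFieldNormedType.Exports.

Set Implicit Arguments.
Unset Strict Implicit.
Unset Printing Implicit Defensive.

Local Open Scope classical_set_scope.
Local Open Scope ring_scope.
Local Open Scope ereal_scope.

Section kpush.
Context d d' (X : measurableType d) (Y : measurableType d') (R : realType).
Variables (K : R.-pker X ~> Y) (Q : probability X R).

Definition kpush : set Y -> \bar R := fun A => \int[Q]_x K x A.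

Let mQ : measurable_fun [set: unit] (fun _ : unit => (Q : pprobability X R)).
Proof. exact: measurable_cst. Qed.

Let kpushE : kpush = mkcomp_noparam (kprobability mQ) K tt.
Proof. by []. Qed.

Let kpush0 : kpush set0 = 0. Proof. by rewrite kpushE measure0. Qed.
Let kpush_ge0 A : 0 <= kpush A. Proof. by rewrite kpushE measure_ge0. Qed.
Let kpush_ssa : semi_sigma_additive kpush.
Proof. rewrite kpushE; exact: measure_semi_sigma_additive. Qed.

HB.instance Definition _ :=
  isMeasure.Build _ _ _ kpush kpush0 kpush_ge0 kpush_ssa.

Let kpushT : kpush setT = 1.
Proof.
rewrite /kpush; under eq_integral do rewrite prob_kernel.
rewrite integral_cst // mul1e. exact: probability_setT.
Qed.

HB.instance Definition _ := Measure_isProbability.Build _ _ _ kpush kpushT.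
End kpush.

(* chi^2 divergence matrix chi^2(P_0 | P_1, ..., P_M):
   ('d Pj '/d P0 is the library Radon-Nikodym derivative.)
   the (j,k) entry is  \int (dP_j/dP_0) dP_k - 1,  for j, k in 1..M.
   P is indexed by 'I_M.+1 (P ord0 = P_0), entries by 'I_M
   (index j : 'I_M stands for P_(j+1) = P (lift ord0 j)). *)
Section chi2.
Context d (T : measurableType d) (R : realType).

Definition chi2_entry (P0 Pj Pk : probability T R) : \bar R :=
  \int[Pk]_x (Radon_Nikodym (charge_of_finite_measure Pj) P0 x) - 1.

Definition chi2 (M : nat) (P : 'I_M.+1 -> probability T R) (j k : 'I_M)
  : \bar R := chi2_entry (P ord0) (P (lift ord0 j)) (P (lift ord0 k)).

(* the chi^2 matrix as a real matrix (meaningful when entries are finite) *)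
Definition chi2mx (M : nat) (P : 'I_M.+1 -> probability T R) : 'M[R]_M :=
  \matrix_(j, k) fine (chi2 P j k).
End chi2.

Definition psd (R : realType) (n : nat) (A : 'M[R]_n) : Prop :=
  forall v : 'cV[R]_n, (0 <= (v^T *m A *m v) ord0 ord0)%R.

Definition loewner_le (R : realType) (n : nat) (A B : 'M[R]_n) : Prop :=
  psd (B - A)%R.

(* Main.v *)
(* Let J be the joint law Q_0(dx) K(x, dy), let q_j = dQ_j/dQ_0 and
   r_j = dKQ_j/dKQ_0. Under J, r_j(y) is the conditional expectation of q_j(x)
   given y, hence an L^2 projection: each r_j is square integrable and
   E_J[r_j q_k] = E_J[r_j r_k]. Therefore the difference of the two chi^2 matrices
   is the Gram matrix of the functions q_j(x) - r_j(y) in L^2(J). *)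
Require Import Defs.
From HB Require Import structures.
From mathcomp Require Import all_boot all_order all_algebra.
From mathcomp Require Import all_classical all_reals all_analysis.
From mathcomp Require Import measurable_realfun ring lra.
Import Order.TTheory GRing.Theory Num.Theory numFieldNormedType.Exports.

Set Implicit Arguments.
Unset Strict Implicit.
Unset Printing Implicit Defensive.

Local Open Scope classical_set_scope.
Local Open Scope ring_scope.
Local Open Scope ereal_scope.

(** * Square-integrable functions: products, an L^2 contraction, Gram matrices *)

Section square_integrable.
Context d (T : measurableType d) (R : realType) (mu : {measure set T -> \bar R}).
Implicit Types f g a b : T -> R.

Lemma integrable_sqr f : measurable_fun setT f ->
  \int[mu]_x ((f x) ^+ 2)%:E < +oo ->
  mu.-integrable setT (fun x => ((f x) ^+ 2)%:E).
Proof.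
move=> mf foo; apply/integrableP; split.
  by apply/measurable_EFinP; exact: measurable_funX.
rewrite (le_lt_trans _ foo)// le_eqVlt; apply/orP; left; apply/eqP.
by apply: eq_integral => x _; rewrite gee0_abs// lee_fin sqr_ge0.
Qed.

(** From (|f| - |g|)^2 >= 0 one gets |f g| <= f^2 + g^2, and the right side is integrable. *)
Lemma integrable_mul_sqr f g :
  measurable_fun setT f -> measurable_fun setT g ->
  \int[mu]_x ((f x) ^+ 2)%:E < +oo -> \int[mu]_x ((g x) ^+ 2)%:E < +oo ->
  mu.-integrable setT (EFin \o (fun x => f x * g x)%R).
Proof.
move=> mf mg foo goo.
have := integrableD measurableT (integrable_sqr mf foo) (integrable_sqr mg goo).
apply: le_integrable => //.
  by apply/measurable_EFinP; exact: measurable_funM.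
move=> x _ /=; rewrite lee_fin normrM.
rewrite (ger0_norm (addr_ge0 (sqr_ge0 (f x)) (sqr_ge0 (g x)))).
rewrite -(real_normK (num_real (f x))) -(real_normK (num_real (g x))).
have := sqr_ge0 (`|f x| - `|g x|)%R.
have := normr_ge0 (f x); have := normr_ge0 (g x).
set s := `|f x|%R; set t := `|g x|%R; move=> s0 t0; nra.
Qed.

(* With c_n = min(b, n),
   int c_n^2 <= int c_n b = int c_n a <= (int c_n^2 + int a^2) / 2,
   and int c_n^2 is finite. *)
Lemma le_integral_sqr_proj a b : mu setT < +oo ->
  measurable_fun setT a -> measurable_fun setT b ->
  (forall x, 0 <= a x)%R -> (forall x, 0 <= b x)%R ->
  (forall n : nat, \int[mu]_x (Num.min (b x) n%:R * a x)%:E =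
                   \int[mu]_x (Num.min (b x) n%:R * b x)%:E) ->
  \int[mu]_x ((b x) ^+ 2)%:E <= \int[mu]_x ((a x) ^+ 2)%:E.
Proof.
move=> muoo ma mb a0 b0 ab.
pose c n x := Num.min (b x) n%:R.
have mc n : measurable_fun setT (c n).
  by apply: measurable_minr => //; exact: measurable_cst.
have c0 n x : (0 <= c n x)%R by rewrite /c le_min b0 ler0n.
have cb n x : (c n x <= b x)%R by rewrite /c ge_min lexx.
have cn n x : (c n x <= n%:R)%R by rewrite /c ge_min lexx orbT.
have le_c n : \int[mu]_x ((c n x) ^+ 2)%:E <= \int[mu]_x ((a x) ^+ 2)%:E.
  (* Finite because c_n <= n and [mu] has finite mass. This is what allows int c_n^2 to be cancelled
     from 2 int c_n^2 <= int c_n^2 + int a^2 below. *)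
  have coo : \int[mu]_x ((c n x) ^+ 2)%:E < +oo.
    apply: (@le_lt_trans _ _ (\int[mu]_x ((n%:R ^+ 2)%R)%:E)).
      apply: ge0_le_integral => //.
      - by move=> x _; rewrite lee_fin sqr_ge0.
      - by apply/measurable_EFinP; exact: measurable_funX.
      - by move=> x _; rewrite lee_fin lerXn2r// nnegrE.
    by rewrite integral_cst// lte_mul_pinfty// ?lee_fin ?sqr_ge0.
  have cfin : \int[mu]_x ((c n x) ^+ 2)%:E \is a fin_num.
    by rewrite ge0_fin_numE// integral_ge0// => x _; rewrite lee_fin sqr_ge0.
  have : \int[mu]_x ((c n x) ^+ 2 *+ 2)%:E <=
         \int[mu]_x ((c n x) ^+ 2 + (a x) ^+ 2)%:E.
    apply: (@le_trans _ _ (\int[mu]_x (c n x * b x *+ 2)%:E)).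
      apply: ge0_le_integral => //.
      - by move=> x _; rewrite lee_fin mulrn_wge0// sqr_ge0.
      - apply/measurable_EFinP; under eq_fun do rewrite -mulr_natl.
        by apply: measurable_funM => //; exact: measurable_funX.
      - apply/measurable_EFinP; under eq_fun do rewrite -mulr_natl.
        by apply: measurable_funM => //; exact: measurable_funM.
      - by move=> x _; rewrite lee_fin lerMn2r expr2 ler_wpM2l ?orbT.
    rewrite [leLHS](_ : _ = \int[mu]_x (c n x * a x *+ 2)%:E); last first.
      under eq_integral do rewrite -mulr_natl EFinM.
      under [RHS]eq_integral do rewrite -mulr_natl EFinM.
      rewrite !ge0_integralZl ?lee_fin//.
      + by rewrite ab.
      + by apply/measurable_EFinP; exact: measurable_funM.
      + by move=> x _; rewrite lee_fin mulr_ge0.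
      + by apply/measurable_EFinP; exact: measurable_funM.
      + by move=> x _; rewrite lee_fin mulr_ge0.
    apply: ge0_le_integral => //.
    - by move=> x _; rewrite lee_fin mulrn_wge0// mulr_ge0.
    - apply/measurable_EFinP; under eq_fun do rewrite -mulr_natl.
      by apply: measurable_funM => //; exact: measurable_funM.
    - by apply/measurable_EFinP; apply: measurable_funD; exact: measurable_funX.
    - move=> x _; rewrite lee_fin.
      have := sqr_ge0 (c n x - a x)%R; rewrite sqrrB; lra.
  under eq_integral do rewrite mulr2n EFinD.
  under [leRHS]eq_integral do rewrite EFinD.
  have mX f : measurable_fun setT f ->
      measurable_fun setT (fun x => ((f x) ^+ 2)%:E).
    by move=> mf; apply/measurable_EFinP; exact: measurable_funX.
  rewrite !ge0_integralD//; [|by move=> ? _; rewrite lee_fin sqr_ge0 |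
    exact: mX | by move=> ? _; rewrite lee_fin sqr_ge0 | exact: mX |
    by move=> ? _; rewrite lee_fin sqr_ge0 | exact: mX |
    by move=> ? _; rewrite lee_fin sqr_ge0 | exact: mX].
  by rewrite leeD2lE.
(* Monotone convergence removes the truncation: at each x the sequence c_n(x)^2 is nondecreasing and
   equals b(x)^2 as soon as n >= b(x). *)
have -> : \int[mu]_x ((b x) ^+ 2)%:E =
    \int[mu]_x (limn (fun n => ((c n x) ^+ 2)%:E)).
  apply: eq_integral => x _; apply/esym/cvg_lim => //.
  apply: cvg_near_cst; near=> n; rewrite /c min_l//.
  near: n; exact: nbhs_infty_ger.
rewrite monotone_convergence//; last 3 first.
- by move=> n; apply/measurable_EFinP; exact: measurable_funX.
- by move=> n x _; rewrite lee_fin sqr_ge0.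
- move=> x _ m n mn; rewrite lee_fin lerXn2r ?nnegrE//.
  by rewrite /c le_min cb/= (le_trans (cn _ _))// ler_nat.
apply: lime_le; last by apply: nearW => n; exact: le_c.
apply: ereal_nondecreasing_is_cvgn => m n mn; apply: ge0_le_integral => //.
- by move=> x _; rewrite lee_fin sqr_ge0.
- by apply/measurable_EFinP; exact: measurable_funX.
- by apply/measurable_EFinP; exact: measurable_funX.
- move=> x _; rewrite lee_fin lerXn2r ?nnegrE//.
  by rewrite /c le_min cb/= (le_trans (cn _ _))// ler_nat.
Unshelve. all: by end_near. Qed.

(** The quadratic form at v is the integral of the square of sum_j v_j u_j; integrability of the
    products lets the double sum pass through the integral. *)
Lemma psd_gram n (u : 'I_n -> T -> R) :
  (forall j k, mu.-integrable setT (EFin \o (fun x => u j x * u k x)%R)) ->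
  psd (\matrix_(j < n, k < n) (\int[mu]_x (u j x * u k x))%R).
Proof.
move=> iu v.
suff -> : ((v^T *m \matrix_(j < n, k < n) (\int[mu]_x (u j x * u k x))%R *m v)
    ord0 ord0 = \int[mu]_x ((\sum_j v j ord0 * u j x) ^+ 2))%R.
  by apply: Rintegral_ge0 => x _; exact: sqr_ge0.
have sumE x : (((\sum_j v j ord0 * u j x) ^+ 2)%:E =
    \sum_k \sum_j (v j ord0 * v k ord0)%:E * (u j x * u k x)%:E).
  rewrite expr2 big_distrlr/= exchange_big/= -sumEFin; apply: eq_bigr => k _.
  rewrite -sumEFin; apply: eq_bigr => j _; rewrite -EFinM; congr EFin.
  by rewrite mulrACA.
rewrite /Rintegral; under eq_integral do rewrite sumE.
have ijk j k : mu.-integrable setT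
    (fun x => (v j ord0 * v k ord0)%:E * (u j x * u k x)%:E).
  by apply: integrableZl => //; exact: iu.
rewrite integral_sum//; last by move=> k; exact: integrable_sum.
rewrite mxE; under eq_bigr do rewrite mxE big_distrl/=.
rewrite -sum_fine; last first.
  move=> k _; rewrite integral_sum//; apply/sum_fin_numP => j _ _.
  exact: integrable_fin_num.
apply: eq_bigr => k _; rewrite integral_sum// -sum_fine; last first.
  by move=> j _; exact: integrable_fin_num.
apply: eq_bigr => j _; rewrite !mxE integralZl//; last exact: iu.
rewrite fineM//; last exact: integrable_fin_num (iu _ _).
by rewrite mulrAC.
Qed.

End square_integrable.

(** * Integration and absolute continuity under the image measure *)

Section kernel_integral.
Context d d' (X : measurableType d) (Y : measurableType d') (R : realType).

Lemma integral_kpush (K : R.-pker X ~> Y) (Q : probability X R)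
    (g : Y -> \bar R) :
  (forall y, 0 <= g y) -> measurable_fun setT g ->
  \int[kpush K Q]_y g y = \int[Q]_x \int[K x]_y g y.
Proof.
move=> g0 mg.
have mQ : measurable_fun [set: unit] (fun _ : unit => (Q : pprobability X R)).
  exact: measurable_cst.
(* [Q] is seen as a constant kernel on the one-point space, so that [kpush K Q] is a composition of
   kernels; [kernel_snd] makes [K] ignore the added [unit] coordinate. *)
exact: (@integral_kcomp _ _ _ _ _ _ _ (kprobability mQ)
  (kernel.kernel_snd K : R.-sfker (unit * X) ~> Y) tt g g0 mg).
Qed.

(** If int K(x,A) dP = 0, the nonnegative function K(.,A) vanishes P-a.e., hence Q-a.e., so its
    Q-integral is zero too. *)
Lemma kpush_dominates (K : R.-pker X ~> Y) (Q P : probability X R) :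
  Q `<< P -> kpush K Q `<< kpush K P.
Proof.
move=> /null_content_dominatesP QP; apply/null_content_dominatesP => A mA PA0.
have mK := measurable_kernel K A mA.
have : ae_eq P setT (fun x => K x A) (cst 0).
  apply/(ae_eq_integral_abs _ measurableT mK).1.
  by under eq_integral do rewrite gee0_abs//.
move=> /(null_dominates_ae_eq measurableT _) => /(_ Q) KQ.
rewrite /= /kpush (ae_eq_integral (cst 0))//.
  by rewrite integral0.
by apply: KQ; apply/null_content_dominatesP.
Qed.

End kernel_integral.

(** * The joint law of a point and its image under the kernel *)

Section pair_kernel.
Context d d' (X : measurableType d) (Y : measurableType d') (R : realType).
Variable K : R.-pker X ~> Y.

(** This is the product of the Dirac mass at x with [K x]. Pushing [Q] through it gives the joint
    law Q(dx) K(x, dy) on X * Y. *)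
Definition pair_push (x : X) : set (X * Y) -> \bar R :=
  pushforward (K x) (pair x).

Let pair_push0 x : pair_push x set0 = 0.
Proof. exact: measure0. Qed.

Let pair_push_ge0 x A : 0 <= pair_push x A.
Proof. exact: measure_ge0. Qed.

Let pair_push_ssa x : semi_sigma_additive (pair_push x).
Proof.
exact: (@measure_semi_sigma_additive _ _ _ (pushforward (K x) (pair x))).
Qed.

HB.instance Definition _ x := isMeasure.Build _ _ _ (pair_push x)
  (pair_push0 x) (pair_push_ge0 x) (@pair_push_ssa x).

Definition pair_kernel : X -> {measure set (X * Y) -> \bar R} := pair_push.

Let measurable_pair_kernel A : measurable A ->
  measurable_fun setT (pair_kernel ^~ A).
Proof.
move=> mA.
(* The mass of A is the [K x]-measure of the x-section of A. *)
have := @measurable_fun_xsection_finite_kernel _ _ _ _ _ K A (mem_set mA).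
congr (measurable_fun _ _); apply/funext => x.
by rewrite /= /pair_kernel /= /pair_push /pushforward xsectionE.
Qed.

HB.instance Definition _ :=
  isKernel.Build _ _ _ _ _ pair_kernel measurable_pair_kernel.

Let prob_pair_kernel x : pair_kernel x setT = 1.
Proof.
by rewrite /pair_kernel /= /pair_push /pushforward preimage_setT prob_kernel.
Qed.

HB.instance Definition _ :=
  Kernel_isProbability.Build _ _ _ _ _ pair_kernel prob_pair_kernel.

Lemma integral_pair_kernel (Q : probability X R) (F : X * Y -> \bar R) :
  (forall z, 0 <= F z) -> measurable_fun setT F ->
  \int[kpush pair_kernel Q]_z F z = \int[Q]_x \int[K x]_y F (x, y).
Proof.
move=> F0 mF; rewrite integral_kpush//; apply: eq_integral => x _.
by rewrite ge0_integral_pushforward.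
Qed.

End pair_kernel.

(** * Real-valued densities and the entries of the chi^2 matrix *)

Section density.
Context d (T : measurableType d) (R : realType).
Implicit Types P Q : probability T R.

(** When P << Q this version of dP/dQ is finite and nonnegative at every point; it agrees almost
    everywhere with the derivative used in [chi2_entry]. *)
Definition density P Q (x : T) : R :=
  fine (Radon_Nikodym_SigmaFinite.f P Q x).

Lemma density_ge0 P Q x : P `<< Q -> (0 <= density P Q x)%R.
Proof. by move=> PQ; exact/fine_ge0/Radon_Nikodym_SigmaFinite.f_ge0. Qed.

Lemma EFin_density P Q x : P `<< Q ->
  (density P Q x)%:E = Radon_Nikodym_SigmaFinite.f P Q x.
Proof. by move=> PQ; rewrite fineK// Radon_Nikodym_SigmaFinite.f_fin_num. Qed.

Lemma measurable_density P Q : P `<< Q -> measurable_fun setT (density P Q).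
Proof.
move=> PQ; apply: measurableT_comp => //.
exact: measurable_int (Radon_Nikodym_SigmaFinite.f_integrable _).
Qed.

Lemma integral_density P Q (f : T -> \bar R) : P `<< Q ->
  (forall x, 0 <= f x) -> measurable_fun setT f ->
  \int[Q]_x (f x * (density P Q x)%:E) = \int[P]_x f x.
Proof.
move=> PQ f0 mf; rewrite -(Radon_Nikodym_SigmaFinite.change_of_variables PQ)//.
by apply: eq_integral => x _; rewrite EFin_density.
Qed.

Lemma chi2_entryE Q P P' : P `<< Q -> P' `<< Q ->
  chi2_entry Q P P' = \int[Q]_x (density P Q x * density P' Q x)%:E - 1.
Proof.
move=> PQ P'Q; rewrite /chi2_entry; congr (_ - _).
under [RHS]eq_integral do rewrite EFinM.
rewrite integral_density//; last 2 first.
- by move=> x; rewrite lee_fin density_ge0.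
- by apply/measurable_EFinP; exact: measurable_density.
apply: ae_eq_integral => //.
- by apply/measurable_EFinP; exact: measurable_density.
(* The two versions of dP/dQ agree Q-a.e., while the integral is against P'; the equality transfers
   because P' << Q. *)
- apply: (null_dominates_ae_eq measurableT P'Q).
  under [X in ae_eq _ _ _ X]eq_fun do rewrite EFin_density//.
  exact/ae_eq_sym/ae_eq_Radon_Nikodym_SigmaFinite.
Qed.

End density.

(** * Marginals of the joint law and conditional expectation *)

Section joint.
Context d d' (X : measurableType d) (Y : measurableType d') (R : realType).
Variables (K : R.-pker X ~> Y) (Q : probability X R).
Local Notation J := (kpush (pair_kernel K) Q).

Lemma integral_joint_fst (g : X -> \bar R) : (forall x, 0 <= g x) ->
  measurable_fun setT g -> \int[J]_z g z.1 = \int[Q]_x g x.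
Proof.
move=> g0 mg; rewrite (@integral_pair_kernel _ _ _ _ _ _ _ (g \o fst)).
- by apply: eq_integral => x _ /=; rewrite integral_cst// prob_kernel mule1.
- by move=> z; exact: g0.
- exact: measurableT_comp.
Qed.

Lemma integral_joint_snd (g : Y -> \bar R) : (forall y, 0 <= g y) ->
  measurable_fun setT g -> \int[J]_z g z.2 = \int[kpush K Q]_y g y.
Proof.
move=> g0 mg; rewrite (@integral_pair_kernel _ _ _ _ _ _ _ (g \o snd)).
- by rewrite integral_kpush.
- by move=> z; exact: g0.
- exact: measurableT_comp.
Qed.

(* The density of [kpush K P] is the conditional expectation under [J], given the
   second coordinate, of the density of [P]. *)
Lemma integral_joint_density (P : probability X R) (h : Y -> R) : P `<< Q ->
  (forall y, 0 <= h y)%R -> measurable_fun setT h ->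
  \int[J]_z (h z.2 * density P Q z.1)%:E =
  \int[J]_z (h z.2 * density (kpush K P) (kpush K Q) z.2)%:E.
Proof.
move=> PQ h0 mh.
have KPQ := kpush_dominates (K := K) PQ.
have mq := measurable_density PQ.
have mr := measurable_density KPQ.
have meh : measurable_fun setT (EFin \o h) by exact/measurable_EFinP.
rewrite (@integral_joint_snd
    (fun y => (h y * density (kpush K P) (kpush K Q) y)%:E)); last 2 first.
- by move=> y; rewrite lee_fin mulr_ge0// density_ge0.
- by apply/measurable_EFinP; exact: measurable_funM.
under [RHS]eq_integral do rewrite EFinM.
rewrite (integral_density (f := EFin \o h) KPQ)//.
(* The right side is now int h d(KP), which equals int (int h dK_x) dP(x). Reinserting the density
   of [P] turns this into the iterated form of the left side. *)
rewrite [RHS]integral_kpush// -(integral_density PQ); last 2 first.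
- by move=> x; apply: integral_ge0 => y _; rewrite lee_fin.
- exact: (measurable_fun_integral_kernel (measurable_kernel K)).
rewrite (@integral_pair_kernel _ _ _ _ _ _ _
    (fun z => (h z.2 * density P Q z.1)%:E)); last 2 first.
- by move=> z; rewrite lee_fin mulr_ge0// density_ge0.
- apply/measurable_EFinP; apply: measurable_funM; exact: measurableT_comp.
apply: eq_integral => x _; rewrite -ge0_integralZr ?lee_fin ?density_ge0//.
by move=> y _; rewrite lee_fin.
Qed.

End joint.

(** A finite diagonal of [chi2 Q] makes the densities square integrable. All entries of both
    matrices are then finite, so [fine] in [chi2mx] loses nothing. *)
Theorem theorem1 (d d' : measure_display)
  (T : measurableType d) (T' : measurableType d') (R : realType)
  (K : R.-pker T ~> T') (M : nat) (Q : 'I_M.+1 -> probability T R) :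
  (0 < M)%N ->
  (forall j : 'I_M, Q (lift ord0 j) `<< Q ord0) ->
  (forall j : 'I_M, chi2 Q j j \is a fin_num) ->
  (forall j k : 'I_M, chi2 (fun i => kpush K (Q i)) j k \is a fin_num) /\
  loewner_le (chi2mx (fun i => kpush K (Q i))) (chi2mx Q).

Proof.
move=> _ QQ chi2Q.
pose J : probability _ R := kpush (pair_kernel K) (Q ord0).
have KQQ j := kpush_dominates (K := K) (QQ j).
pose q (j : 'I_M) := density (Q (lift ord0 j)) (Q ord0).
pose r (j : 'I_M) := density (kpush K (Q (lift ord0 j))) (kpush K (Q ord0)).
have q0 j x : (0 <= q j x)%R by exact/density_ge0/QQ.
have r0 j y : (0 <= r j y)%R by exact/density_ge0/KQQ.
have mq j : measurable_fun setT (q j) by exact/measurable_density/QQ.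
have mr j : measurable_fun setT (r j) by exact/measurable_density/KQQ.
have mq1 j : measurable_fun setT (fun z : T * T' => q j z.1).
  exact: (measurableT_comp (mq j) measurable_fst).
have mr2 j : measurable_fun setT (fun z : T * T' => r j z.2).
  exact: (measurableT_comp (mr j) measurable_snd).
have chi2QE j k : chi2 Q j k = \int[J]_z (q j z.1 * q k z.1)%:E - 1.
  rewrite /chi2 chi2_entryE; [|exact: QQ|exact: QQ].
  rewrite (@integral_joint_fst _ _ _ _ _ _ _
    (fun x => (q j x * q k x)%:E))//.
  - by move=> x; rewrite lee_fin mulr_ge0.
  - by apply/measurable_EFinP; exact: measurable_funM.
have chi2KQE j k : chi2 (fun i => kpush K (Q i)) j k =
    \int[J]_z (r j z.2 * r k z.2)%:E - 1.
  rewrite /chi2 chi2_entryE; [|exact: KQQ|exact: KQQ].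
  rewrite (@integral_joint_snd _ _ _ _ _ _ _
    (fun y => (r j y * r k y)%:E))//.
  - by move=> y; rewrite lee_fin mulr_ge0.
  - by apply/measurable_EFinP; exact: measurable_funM.
have qoo j : \int[J]_z ((q j z.1) ^+ 2)%:E < +oo.
  under eq_integral do rewrite expr2.
  have := chi2Q j; rewrite chi2QE fin_numB => /andP[+ _].
  by rewrite ge0_fin_numE// integral_ge0// => z _; rewrite lee_fin mulr_ge0.
(* The L^2 contraction is applied with a = q_j and b = r_j; its hypothesis is the conditional
   expectation identity tested on h = min(r_j, n). *)
have roo j : \int[J]_z ((r j z.2) ^+ 2)%:E < +oo.
  apply: le_lt_trans (qoo j); apply: le_integral_sqr_proj => //.
    by apply: (@le_lt_trans _ _ 1); [exact: probability_le1|exact: ltry].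
  move=> n; apply: (@integral_joint_density _ _ _ _ _ _ _ _
      (fun y => Num.min (r j y) n%:R)) => //.
    by move=> y; rewrite le_min r0 ler0n.
  by apply: measurable_minr => //; exact: measurable_cst.
have iqq j k := integrable_mul_sqr (mq1 j) (mq1 k) (qoo j) (qoo k).
have iqr j k := integrable_mul_sqr (mq1 j) (mr2 k) (qoo j) (roo k).
have irq j k := integrable_mul_sqr (mr2 j) (mq1 k) (roo j) (qoo k).
have irr j k := integrable_mul_sqr (mr2 j) (mr2 k) (roo j) (roo k).
(* The same identity with the untruncated test function h = r_j. *)
have rqE j k : (\int[J]_z (r j z.2 * q k z.1) = \int[J]_z (r j z.2 * r k z.2))%R.
  by rewrite /Rintegral (integral_joint_density K (QQ k) (r0 j) (mr j)).
have qrE j k : (\int[J]_z (q j z.1 * r k z.2) = \int[J]_z (r j z.2 * r k z.2))%R.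
  under eq_Rintegral do rewrite mulrC.
  by rewrite rqE; apply: eq_Rintegral => z _; rewrite mulrC.
split=> [j k|].
  rewrite chi2KQE fin_numB andbT; exact: integrable_fin_num (irr j k).
have expand j k z : ((q j z.1 - r j z.2) * (q k z.1 - r k z.2) =
    (q j z.1 * q k z.1 - q j z.1 * r k z.2) -
    (r j z.2 * q k z.1 - r j z.2 * r k z.2))%R.
  ring.
have iB f g : J.-integrable setT (EFin \o f) -> J.-integrable setT (EFin \o g) ->
    J.-integrable setT (EFin \o (fun z => f z - g z)%R).
  exact: (@integrableB _ _ _ J _ measurableT (EFin \o f) (EFin \o g)).
rewrite /loewner_le (_ : (chi2mx Q - _)%R = \matrix_(j < M, k < M)
  (\int[J]_z ((q j z.1 - r j z.2) * (q k z.1 - r k z.2)))%R).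
  apply: (@psd_gram _ _ _ J _ (fun j z => q j z.1 - r j z.2)%R) => j k.
  under eq_fun do rewrite expand.
  by apply: (iB); apply: iB.
apply/matrixP => j k; rewrite !mxE chi2QE chi2KQE.
(* Finiteness matters here: [fine] sends infinite values to 0. *)
have fineB1 (x : \bar R) : x \is a fin_num -> (fine (x - 1) = fine x - 1)%R.
  by move=> xfin; rewrite fineB.
rewrite (fineB1 _ (integrable_fin_num measurableT (iqq j k))).
rewrite (fineB1 _ (integrable_fin_num measurableT (irr j k))).
under [RHS]eq_Rintegral do rewrite expand.
rewrite !RintegralB//; [|exact: iB|exact: iB].
(* Both cross terms become int r_j r_k, leaving int q_j q_k - int r_j r_k; the constants 1 of the
   two chi^2 entries cancel. *)
rewrite rqE qrE /Rintegral /=; ring.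
Qed.
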